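(* For every $x \in (0,1)$, the quantity $$W(x) = \sup_{f \in C[0,1],\ f \neq \mathrm{const}}\ \ \sup_{n = 1,2,\ldots}\ \frac{\Delta_n[f](x)}{J_n[f](x)}$$ satisfies $$\frac{1}{\pi} \le W(x) \le 2 .$$
   Context: $C[0,1]$ is the set of continuous real-valued functions on $[0,1]$. For $f \in C[0,1]$ and a positive integer $n$, the Bernstein polynomial is $$B_n[f](x) = \sum_{m=0}^n \binom{n}{m} f\left(\frac{m}{n}\right) x^m (1-x)^{n-m},$$ and the non-uniform error is $\Delta_n[f](x) = |B_n[f](x) - f(x)|$. The modulus of continuity of $f$ is $$\omega[f](\delta) = \sup_{x,y \in [0,1],\ |x-y| \le \delta} |f(x)-f(y)|, \quad \delta \ge 0.$$ For $x\in(0,1)$, $\theta(x) = \sqrt{x(1-x)}$, and $$J_n[f](x) = \int_0^\infty \omega[f]\left(\frac{z\,\theta(x)}{\sqrt{n}}\right) z \exp\left(-\frac{z^2}{2}\right) dz .$$ The first supremum is over all non-constant $f \in C[0,1]$. *)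

(* Defs.v *)
From HB Require Import structures.
From mathcomp Require Export all_boot all_order all_algebra.
From mathcomp Require Export all_classical all_reals all_analysis.

Set Implicit Arguments.
Unset Strict Implicit.
Unset Printing Implicit Defensive.

Import Order.TTheory GRing.Theory Num.Theory.
Import numFieldNormedType.Exports.

Local Open Scope classical_set_scope.
Local Open Scope ring_scope.

(* A function in C[0,1] is represented by any f : R -> R whose restriction to
   [0,1] is continuous; for x in [0,1], no definition below depends on
   the values of f outside [0,1]. *)
Definition C01 (R : realType) : set (R -> R) :=
  [set f : R -> R | {within `[0, 1], continuous f}].

Definition constant01 (R : realType) (f : R -> R) : Prop :=
  exists c : R, forall y : R, y \in `[0, 1] -> f y = c.

Definition bernstein (R : realType) (n : nat) (f : R -> R) (x : R) : R :=
  \sum_(m < n.+1)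
     'C(n, m)%:R * f (m%:R / n%:R) * x ^+ m * (1 - x) ^+ (n - m).

Definition bernstein_error (R : realType) (n : nat) (f : R -> R) (x : R) : R :=
  `|bernstein n f x - f x|.

(* For f in C01 and 0 <= delta this set is nonempty and bounded, so the
   real-valued [sup] is the actual supremum. *)
Definition modulus_of_continuity (R : realType) (f : R -> R) (delta : R) : R :=
  sup [set r | exists u v : R,
         [/\ u \in `[0, 1], v \in `[0, 1], `|u - v| <= delta
           & r = `|f u - f v|] ].

Definition theta (R : realType) (x : R) : R := Num.sqrt (x * (1 - x)).

(* For f in C01 the integrand is nonnegative, measurable and dominated by
   C * z * exp (- z^2 / 2), so the real-valued integral is the actual one.
   If moreover f is non-constant, x is in (0,1) and n > 0, it is positive. *)
Definition Jint (R : realType) (n : nat) (f : R -> R) (x : R) : R :=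
  \int[@lebesgue_measure R]_(z in `[0, +oo[)
     (modulus_of_continuity f (z * theta x / Num.sqrt n%:R)
        * z * expR (- (z ^+ 2 / 2))).

(* The suprema are taken in the extended reals, so that finiteness of W is
   not presupposed. *)
Definition W (R : realType) (x : R) : \bar R :=
  ereal_sup
    [set ereal_sup
           [set (bernstein_error n f x / Jint n f x)%:E | n in [set n | (0 < n)%N]]
      | f in [set f : R -> R | C01 f /\ ~ constant01 f] ].

(* Main.v *)
Require Import Defs.
From mathcomp Require Import all_boot all_order all_algebra.
From mathcomp Require Import all_classical all_reals all_analysis.
From mathcomp Require Import measurable_realfun ring lra.
Local Open Scope classical_set_scope.
Local Open Scope ring_scope.

(** Write [w] for the modulus of continuity of [f] and
    sigma = theta x / sqrt n for the standard deviation of S / n, where S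
    is binomial with parameters [n] and [x].

    Upper bound. The Bernstein polynomial is the mean of f (S / n), so the
    error is at most the mean of |f (S / n) - f x|.  Cutting a segment into
    pieces of length at most [d] gives
    |f u - f v| <= w d * (1 + (u - v)^2 / d^2) ([le_modulus_sqr]), and the mean
    of (S / n - x)^2 is sigma^2 ([binomial_mean_variance]).  With
    d = z * sigma this reads
      error <= w (z * sigma) * (1 + 1 / z^2)   for every z > 0
    ([bernstein_error_le_scaled_modulus]): the variance alone controls the
    error at all scales at once.  Now average the resulting lower bound for w (z * sigma) against the Rayleigh
    density z * exp (- z^2 / 2):
      J >= error * int_0^oo z^2 / (1 + z^2) * z * exp (- z^2 / 2) dz.
    That integral is not elementary, but the slightly smaller function
    [tail_minorant] has an elementary primitive against the Rayleigh density
    and integral exactly 1 / 2 ([tail_minorant_integral]).  Hence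
    error <= 2 * J ([bernstein_error_le_Jint]).

    Lower bound. For n = 1 only f 0, f 1 and f x matter.  A continuous
    function with values in [0, 1] on the unit interval, equal to 1 at both
    ends and to 0 at x ([dip]), has error 1, while [w] <= 1 gives J <= 1
    because the Rayleigh density has mass 1.  So W x >= 1 >= 1 / pi.  The upper
    bound, applied to this function, also shows that J is nonzero, so that
    the quotient is a true one. *)

Set Implicit Arguments.
Unset Strict Implicit.
Unset Printing Implicit Defensive.
Import Order.TTheory GRing.Theory Num.Theory.
Import numFieldNormedType.Exports.

(** * Means under the binomial distribution *)

Section BinomialMean.
Variables (R : realType) (x : R).
Implicit Types (n : nat) (g : nat -> R).

Definition binomial_mean n g : R :=
  \sum_(m < n.+1) 'C(n, m)%:R * g m * x ^+ m * (1 - x) ^+ (n - m).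

(** Conditioning on one Bernoulli trial: the trial fails with probability
    1 - x and adds one success with probability x.  In coefficients this is
    Pascal's rule; it lets moments be computed by induction on [n]. *)
Lemma binomial_meanS n g :
  binomial_mean n.+1 g =
  (1 - x) * binomial_mean n g + x * binomial_mean n (g \o succn).
Proof.
rewrite /binomial_mean big_ord_recl bin0 subn0 expr0 mulr1 mul1r.
under eq_bigr => m _ do rewrite lift0 binS natrD subSS !mulrDl.
rewrite big_split /= addrA; congr (_ + _); last first.
  rewrite mulr_sumr; apply: eq_bigr => m _; rewrite exprS; ring.
transitivity (\sum_(m < n.+2)
    'C(n, m)%:R * g m * x ^+ m * (1 - x) ^+ (n.+1 - m)).
  by rewrite [RHS]big_ord_recl /= bin0 expr0 mulr1 mul1r subn0.
rewrite big_ord_recr /= bin_small// !mul0r addr0 mulr_sumr.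
by apply: eq_bigr => m _; rewrite subSn ?leq_ord// exprS; ring.
Qed.

Lemma binomial_mean1 n : binomial_mean n (fun=> 1) = 1.
Proof.
elim: n => [|n IHn]; last by rewrite binomial_meanS /comp IHn; ring.
by rewrite /binomial_mean big_ord1 bin0 subnn !expr0 !mulr1.
Qed.

(** The shift [t] is free so that the induction on [n] closes: one more success
    is the same as replacing [t] by t + 1. *)
Lemma binomial_mean_sqrD n t :
  binomial_mean n (fun m => (m%:R + t) ^+ 2) =
  n%:R * x * (1 - x) + (n%:R * x + t) ^+ 2.
Proof.
elim: n t => [|n IHn] t.
  by rewrite /binomial_mean big_ord1 /= bin0 !expr0; ring.
rewrite binomial_meanS IHn.
have -> : (fun m => (m%:R + t) ^+ 2) \o succn = fun m => (m%:R + (t + 1)) ^+ 2.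
  by apply/funext => m /=; rewrite -natr1; congr (_ ^+ 2); ring.
by rewrite IHn -natr1; ring.
Qed.

Lemma binomial_meanD n g h :
  binomial_mean n (g \+ h) = binomial_mean n g + binomial_mean n h.
Proof. by rewrite -big_split; apply: eq_bigr => m _ /=; ring. Qed.

Lemma binomial_meanZ n c g :
  binomial_mean n (fun m => c * g m) = c * binomial_mean n g.
Proof. by rewrite /binomial_mean mulr_sumr; apply: eq_bigr => m _; ring. Qed.

Hypothesis x01 : 0 <= x <= 1.

Lemma le_binomial_mean n g h :
  (forall m, (m <= n)%N -> g m <= h m) ->
  binomial_mean n g <= binomial_mean n h.
Proof.
move: x01 => /andP[x0 x1] gh; apply: ler_sum => m _.
rewrite ler_wpM2r ?exprn_ge0 ?subr_ge0// ler_wpM2r ?exprn_ge0//.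
by rewrite ler_wpM2l// gh// -ltnS.
Qed.

Lemma le_norm_binomial_mean n g :
  `|binomial_mean n g| <= binomial_mean n (fun m => `|g m|).
Proof.
move: x01 => /andP[x0 x1]; apply: le_trans (ler_norm_sum _ _ _) _.
apply: ler_sum => m _; rewrite !normrM !normrX normr_nat.
by rewrite (ger0_norm x0) (@ger0_norm _ (1 - x)) // subr_ge0.
Qed.

End BinomialMean.

Lemma binomial_mean_variance (R : realType) (x : R) n : (0 < n)%N ->
  binomial_mean x n (fun m => (m%:R / n%:R - x) ^+ 2) = x * (1 - x) / n%:R.
Proof.
move=> n0; have nN0 : n%:R != 0 :> R by rewrite pnatr_eq0 -lt0n.
transitivity (binomial_mean x n
    (fun m => n%:R ^- 2 * (m%:R + (- (n%:R * x))) ^+ 2)).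
  by congr binomial_mean; apply/funext => m; field.
by rewrite binomial_meanZ binomial_mean_sqrD; field.
Qed.

(** * The modulus of continuity *)

Section Modulus.
Variables (R : realType) (f : R -> R).
Local Notation w := (modulus_of_continuity f).

Definition bounded01_by (c : R) := forall y, y \in `[0, 1] -> `|f y| <= c.

Lemma C01_bounded : C01 f -> exists c, bounded01_by c.
Proof.
move=> cf; have [a _ fa] := EVT_max ler01 cf.
have [b _ fb] := EVT_min ler01 cf.
exists (`|f a| + `|f b|) => y y01.
rewrite ler_norml; apply/andP; split.
  have := fb _ y01; have := ler_norm (- f b); rewrite normrN.
  have := normr_ge0 (f a); lra.
have := fa _ y01; have := ler_norm (f a).
have := normr_ge0 (f b); lra.
Qed.

Lemma modulus_le (c d : R) : 0 <= c ->
  (forall u v, u \in `[0, 1] -> v \in `[0, 1] -> `|f u - f v| <= c) ->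
  w d <= c.
Proof.
move=> c0 fc; rewrite /modulus_of_continuity.
set S := [set _ | _]; have [[r Sr]|S0] := pselect (S !=set0).
  by apply: ge_sup; [exists r|move=> _ [u [v [u01 v01 _ ->]]]; exact: fc].
by rewrite sup_out// => -[].
Qed.

Hypothesis cf : C01 f.

Lemma modulus_has_ub (d : R) :
  has_ubound [set r | exists u v : R,
    [/\ u \in `[0, 1], v \in `[0, 1], `|u - v| <= d & r = `|f u - f v|] ].
Proof.
have [c fc] := C01_bounded cf.
exists (c + c) => _ [u [v [u01 v01 _ ->]]].
by rewrite (le_trans (ler_normB _ _))// lerD// fc.
Qed.

Lemma le_modulus (u v d : R) : u \in `[0, 1] -> v \in `[0, 1] ->
  `|u - v| <= d -> `|f u - f v| <= w d.
Proof.
by move=> u01 v01 uvd; apply: ub_le_sup; [exact: modulus_has_ub|exists u, v].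
Qed.

Lemma modulus_ge0 (d : R) : 0 <= w d.
Proof.
rewrite /modulus_of_continuity.
set S := [set _ | _]; have [[r Sr]|S0] := pselect (S !=set0); last first.
  by rewrite sup_out// => -[].
have [u [v [_ _ _ rE]]] := Sr.
apply: (@le_trans _ _ r); first by rewrite rE.
by apply: ub_le_sup Sr; exact: modulus_has_ub.
Qed.

Lemma modulus_nondecreasing : {homo w : d e / d <= e}.
Proof.
move=> d e de; rewrite {1}/modulus_of_continuity.
set S := [set _ | _]; have [[r Sr]|S0] := pselect (S !=set0).
  apply: ge_sup; first by exists r.
  move=> _ [u [v [u01 v01 uvd ->]]].
  by apply: le_modulus => //; exact: le_trans de.
by rewrite sup_out ?modulus_ge0// => -[].
Qed.

(** Split the segment from [v] to [u] into [k] equal pieces; the induction peels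
    off the piece next to [v]. *)
Lemma modulus_subdivision (k : nat) (u v d : R) :
  u \in `[0, 1] -> v \in `[0, 1] -> `|u - v| <= k%:R * d ->
  `|f u - f v| <= k%:R * w d.
Proof.
elim: k u v => [|k IHk] u v u01 v01.
  by rewrite !mul0r normr_le0 subr_eq0 => /eqP ->; rewrite subrr normr0.
have k1 : 0 < k.+1%:R :> R by [].
move=> uv; pose p := v + (u - v) / k.+1%:R.
have p01 : p \in `[0, 1].
  move: u01 v01; rewrite !in_itv /= => /andP[u0 u1] /andP[v0 v1].
  have -> : p = (k%:R * v + u) / k.+1%:R by rewrite /p -natr1; field.
  have k0 : 0 <= k%:R :> R by [].
  rewrite divr_ge0 ?addr_ge0 ?mulr_ge0//= ler_pdivrMr// -natr1; nra.
rewrite -natr1 mulrDl mul1r (le_trans (ler_distD (f p) _ _))// lerD//.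
  apply: IHk => //.
  have -> : u - p = (k%:R / k.+1%:R) * (u - v) by rewrite /p -natr1; field.
  rewrite normrM ger0_norm ?divr_ge0// mulrAC ler_pdivrMr// -mulrA.
  by rewrite ler_wpM2l// mulrC.
apply: le_modulus => //.
have -> : p - v = (u - v) / k.+1%:R by rewrite /p; ring.
by rewrite normrM normfV (ger0_norm (ltW k1)) ler_pdivrMr// mulrC.
Qed.

(** With t = |u - v| / d, floor t + 1 pieces suffice, and floor t <= t^2 because
    floor t = 0 unless t >= 1.  The quadratic bound is what makes the second
    moment of the binomial distribution sufficient. *)
Lemma le_modulus_sqr (u v d : R) : u \in `[0, 1] -> v \in `[0, 1] -> 0 < d ->
  `|f u - f v| <= w d * (1 + (u - v) ^+ 2 / d ^+ 2).
Proof.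
move=> u01 v01 d0; set t := `|u - v| / d.
have t0 : 0 <= t by rewrite divr_ge0// ltW.
have -> : (u - v) ^+ 2 / d ^+ 2 = t ^+ 2.
  by rewrite -real_normK ?num_real// -expr_div_n.
have /andP[kt tk] := truncn_itv t0.
have uvk : `|u - v| <= (Num.truncn t).+1%:R * d by rewrite -ler_pdivrMr// ltW.
rewrite (le_trans (modulus_subdivision u01 v01 uvk))// mulrC.
rewrite ler_wpM2l ?modulus_ge0// -natr1 addrC lerD2l.
case: (Num.truncn t) kt => [|k] kt; first by rewrite exprn_ge0.
have : 1 <= t by rewrite (le_trans _ kt)// ler1n.
by nra.
Qed.

End Modulus.

(** * Integrals against the Rayleigh density *)

Section HalfLineIntegrals.
Variable R : realType.
Local Notation mu := (@lebesgue_measure R).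
Implicit Types f F : R -> R.

Lemma is_derive_continuous F f : (forall z : R, is_derive z 1 F (f z)) ->
  continuous F.
Proof.
by move=> dF z; apply: differentiable_continuous; apply/derivable1_diffP.
Qed.

(** For a nonnegative integrand, a primitive with a finite limit at infinity
    gives integrability together with the value, which comparing real-valued
    integrals requires. *)
Lemma ge0_FTC2y_integrable f F a l :
  (forall z, a <= z -> 0 <= f z) -> continuous f ->
  F z @[z --> +oo%R] --> l -> (forall z : R, is_derive z 1 F (f z)) ->
  mu.-integrable `[a, +oo[ (EFin \o f) /\
  \int[mu]_(z in `[a, +oo[) f z = l - F a.
Proof.
move=> f0 cf Fl dF.
have intE : (\int[mu]_(z in `[a, +oo[) (f z)%:E = l%:E - (F a)%:E)%E.
  apply: ge0_continuous_FTC2y => //.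
  - exact: continuous_subspaceT.
  - by apply: cvg_at_right_filter; exact: (is_derive_continuous dF).
  - by move=> z _; rewrite derive1E derive_val.
split; last by rewrite /Rintegral intE.
apply/integrableP; split.
  apply/measurable_EFinP; apply: measurable_funTS.
  exact: continuous_measurable_fun.
rewrite (_ : (\int[mu]_(z in _) _)%E = (l - F a)%:E) ?ltry//.
rewrite EFinB -intE; apply: eq_integral => z /=.
by rewrite inE /= in_itv /= andbT => az; rewrite ger0_norm// f0.
Qed.

Lemma integrable_scale (D : set (measurableTypeR R)) (c : R) f : measurable D ->
  mu.-integrable D (EFin \o f) -> mu.-integrable D (EFin \o (fun z => c * f z)).
Proof. by move=> mD fi; exact: (integrableZl mD c fi). Qed.

Definition gauss_weight (z : R) := expR (- (z ^+ 2 / 2)).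

Lemma is_derive_gauss_weight (z : R) :
  is_derive z 1 gauss_weight (- (z * gauss_weight z)).
Proof.
have dq : is_derive z 1 (fun y : R => - (y ^+ 2 / 2)) (- z).
  apply: is_derive_eq; rewrite /GRing.scale /=; lra.
have := @is_derive1_comp _ expR _ z _ _ (is_derive_expR _) dq.
by move/is_derive_eq; apply; rewrite mulrN mulrC.
Qed.

Lemma continuous_gauss_weight : continuous gauss_weight.
Proof. exact: is_derive_continuous is_derive_gauss_weight. Qed.

Lemma cvg_gauss_weight : gauss_weight z @[z --> +oo%R] --> 0.
Proof.
apply: (cvg_comp (fun z : R => z ^+ 2 / 2) (fun z => expR (- z))).
  apply: gt0_cvgMly => //; exact: cvgr_expr2.
exact: cvgr_expR.
Qed.

Lemma rayleigh_density_integral :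
  mu.-integrable `[0, +oo[ (EFin \o (fun z => z * gauss_weight z)) /\
  \int[mu]_(z in `[0, +oo[) (z * gauss_weight z) = 1.
Proof.
have -> : 1 = 0 - (- gauss_weight 0).
  by rewrite /gauss_weight expr0n mul0r oppr0 expR0 sub0r opprK.
apply: (@ge0_FTC2y_integrable _ (fun z => - gauss_weight z)).
- by move=> z z0; rewrite mulr_ge0// expR_ge0.
- by move=> z; apply: cvgM; [exact: cvg_id|exact: continuous_gauss_weight].
- by rewrite -oppr0; apply: cvgN; exact: cvg_gauss_weight.
- move=> z; have dg := is_derive_gauss_weight z.
  by apply: is_derive_eq; rewrite opprK.
Qed.

(** A lower bound for z^2 / (1 + z^2) found from its primitive: if
    [q] = 1 - 1 / (2 + z^2), then - exp (- z^2 / 2) * q has derivative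
    z * exp (- z^2 / 2) * (q - 2 / (2 + z^2)^2), and the last factor is this
    function.  Among the corrections 1 / (b + z^2), b = 2 gives the total mass
    1 - 1 / 2 and still leaves a minorant. *)
Definition tail_minorant (z : R) := z ^+ 2 * (z ^+ 2 + 3) / (2 + z ^+ 2) ^+ 2.

Lemma tail_minorant_ge0 z : 0 <= tail_minorant z.
Proof.
have z2 := sqr_ge0 z; rewrite /tail_minorant divr_ge0 ?sqr_ge0//.
by rewrite mulr_ge0// addr_ge0.
Qed.

(** After clearing denominators this is
    (z^2 + 1) * (z^2 + 3) <= (z^2 + 2)^2. *)
Lemma tail_minorant_le z : (1 + z ^- 2) * tail_minorant z <= 1.
Proof.
have z2 := sqr_ge0 z.
have [->|z0] := eqVneq z 0; first by rewrite /tail_minorant expr0n !mul0r mulr0.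
rewrite /tail_minorant.
have -> : (1 + z ^- 2) * (z ^+ 2 * (z ^+ 2 + 3) / (2 + z ^+ 2) ^+ 2) =
   (z ^+ 2 + 1) * (z ^+ 2 + 3) / (2 + z ^+ 2) ^+ 2.
  by field; rewrite z0 lt0r_neq0//; lra.
rewrite ler_pdivrMr ?mul1r; last by apply: exprn_gt0; lra.
nra.
Qed.

Lemma tail_minorant_integral :
  mu.-integrable `[0, +oo[
    (EFin \o (fun z => tail_minorant z * (z * gauss_weight z))) /\
  \int[mu]_(z in `[0, +oo[) (tail_minorant z * (z * gauss_weight z)) = 1 / 2.
Proof.
pose F := fun z : R => gauss_weight z * ((2 + z ^+ 2)^-1 - 1).
have d0 (z : R) : 2 + z ^+ 2 != 0 by rewrite lt0r_neq0// ltr_wpDr ?sqr_ge0.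
have -> : 1 / 2 = 0 - F 0.
  by rewrite /F /gauss_weight expr0n mul0r oppr0 expR0 /= addr0; lra.
have dd (z : R) : is_derive z 1 (fun y : R => 2 + y ^+ 2) (2 * z).
  by apply: is_derive_eq; rewrite /GRing.scale /=; ring.
have dV (z : R) : is_derive z 1 (fun y : R => (2 + y ^+ 2)^-1)
    (- (2 + z ^+ 2) ^- 2 * (2 * z)).
  exact: (@is_deriveV _ (fun y : R => 2 + y ^+ 2) _ _ _ (d0 z) (dd z)).
have cV := is_derive_continuous dV.
apply: (@ge0_FTC2y_integrable _ F).
- move=> z z0; apply: mulr_ge0; first exact: tail_minorant_ge0.
  by rewrite mulr_ge0// expR_ge0.
- move=> z; apply: cvgM; last first.
    by apply: cvgM; [exact: cvg_id|exact: continuous_gauss_weight].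
  have -> : tail_minorant =
      fun y => y ^+ 2 * (y ^+ 2 + 3) * (2 + y ^+ 2)^-1 ^+ 2.
    by apply/funext => y; rewrite /tail_minorant -exprVn.
  apply: cvgM; last first.
    apply: (cvg_comp (fun y : R => (2 + y ^+ 2)^-1) (fun y => y ^+ 2)).
      exact: cV.
    exact: exprn_continuous.
  apply: cvgM; first exact: exprn_continuous.
  by apply: cvgD; [exact: exprn_continuous|exact: cvg_cst].
- apply: (@squeeze_cvgr _ _ _ _ (fun z => - gauss_weight z) (cst 0)).
  (* the second factor of F lies between -1 and 0 *)
  + apply: nearW => z; rewrite /F /=.
    have i0 : 0 < (2 + z ^+ 2)^-1 by rewrite invr_gt0 ltr_wpDr ?sqr_ge0.
    have i1 : (2 + z ^+ 2)^-1 <= 1.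
      by rewrite invf_le1 ?ltr_wpDr ?sqr_ge0//; have := sqr_ge0 z; lra.
    have := expR_ge0 (- (z ^+ 2 / 2)); rewrite -/(gauss_weight z); nra.
  + by rewrite -oppr0; apply: cvgN; exact: cvg_gauss_weight.
  + exact: cvg_cst.
- move=> z; have dg := is_derive_gauss_weight z; have dVz := dV z.
  have dV1 : is_derive z 1 (fun y : R => (2 + y ^+ 2)^-1 - 1)
      (- (2 + z ^+ 2) ^- 2 * (2 * z)).
    by apply: is_derive_eq; rewrite subr0.
  have := is_deriveM dg dV1.
  by move/is_derive_eq; apply; rewrite /tail_minorant /GRing.scale /=; field.
Qed.

End HalfLineIntegrals.

(** * The error is at most twice the integral *)

Section BernsteinError.
Variables (R : realType) (f : R -> R) (n : nat) (x : R).
Hypotheses (cf : C01 f) (n_gt0 : (0 < n)%N) (x_gt0 : 0 < x) (x_lt1 : x < 1).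
Local Notation mu := (@lebesgue_measure R).
Local Notation w := (modulus_of_continuity f).

Lemma bernstein_error_le_modulus d : 0 < d ->
  bernstein_error n f x <= w d * (1 + x * (1 - x) / n%:R / d ^+ 2).
Proof.
move=> d0; have x01 : 0 <= x <= 1 by rewrite !ltW.
have fxE : f x = binomial_mean x n (fun=> f x * 1).
  by rewrite binomial_meanZ binomial_mean1 mulr1.
have -> : bernstein_error n f x =
    `|binomial_mean x n (fun m => f (m%:R / n%:R) - f x)|.
  rewrite /bernstein_error {1}fxE
    -[- binomial_mean _ _ _]mulN1r -binomial_meanZ.
  rewrite -[bernstein n f x]/(binomial_mean x n (fun m => f (m%:R / n%:R))).
  rewrite -binomial_meanD; congr `|binomial_mean x n _|.
  by apply/funext => m /=; ring.
apply: (le_trans (le_norm_binomial_mean x01 _ _)).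
rewrite -(binomial_mean_variance x n_gt0).
pose h m : R := (m%:R / n%:R - x) ^+ 2.
apply: (@le_trans _ _ (binomial_mean x n
    (fun m => w d * ((fun=> 1) \+ (fun m => d ^- 2 * h m)) m))).
  apply: le_binomial_mean => // m mn.
  rewrite /= [d ^- 2 * _]mulrC; apply: le_modulus_sqr => //.
  by rewrite in_itv /= divr_ge0//= ler_pdivrMr ?ltr0n// mul1r ler_nat.
by rewrite binomial_meanZ binomial_meanD binomial_mean1 binomial_meanZ
  [_ / d ^+ 2]mulrC.
Qed.

Let scale z := z * theta x / Num.sqrt n%:R.

Let theta_gt0 : 0 < theta x.
Proof. by rewrite sqrtr_gt0 mulr_gt0// subr_gt0. Qed.

Let sqrtn_gt0 : 0 < Num.sqrt n%:R :> R.
Proof. by rewrite sqrtr_gt0 ltr0n. Qed.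

(** At d = z * sigma the variance x * (1 - x) / n cancels, leaving 1 / z^2. *)
Lemma bernstein_error_le_scaled_modulus z : 0 < z ->
  bernstein_error n f x <= w (scale z) * (1 + z ^- 2).
Proof.
move=> z0; have s0 : 0 < scale z by rewrite divr_gt0// mulr_gt0.
apply: le_trans (bernstein_error_le_modulus s0) _.
have x1 : 0 < 1 - x by rewrite subr_gt0.
rewrite le_eqVlt; apply/orP; left; apply/eqP; congr (_ * (1 + _)).
rewrite /scale /theta !expr_div_n exprMn !sqr_sqrtr ?ler0n ?mulr_ge0 ?ltW//.
by field; rewrite !gt_eqF//= ltr0n.
Qed.

Local Notation integrand :=
  (fun z : R => w (scale z) * z * gauss_weight z).

(** The modulus is monotone, hence measurable, and its bound [c] reduces the
    integrand to a multiple of the Rayleigh density. *)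
Lemma Jint_integrable c : (forall d, w d <= c) ->
  mu.-integrable `[0, +oo[ (EFin \o integrand).
Proof.
move=> wc; have [rint _] := rayleigh_density_integral R.
have : mu.-integrable `[0, +oo[ (EFin \o (fun z => c * (z * gauss_weight z))).
  exact: integrable_scale.
apply: le_integrable => //.
- apply/measurable_EFinP; apply: measurable_funTS.
  apply: measurable_funM; last first.
    exact: continuous_measurable_fun (@continuous_gauss_weight R).
  apply: measurable_funM => //; apply: nondecreasing_measurable => // y z yz.
  apply: modulus_nondecreasing => //.
  by rewrite /scale -!mulrA ler_wpM2r// divr_ge0// ltW.
- move=> z /=; rewrite in_itv /= andbT => z0.
  have e0 : 0 <= gauss_weight z := expR_ge0 _.
  have w0 := modulus_ge0 cf (scale z).
  rewrite lee_fin !ger0_norm ?mulr_ge0 ?(le_trans w0 (wc _))//.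
  by rewrite -mulrA ler_wpM2r ?mulr_ge0.
Qed.

Lemma modulus_bounded : exists c, forall d, w d <= c.
Proof.
have [c fc] := C01_bounded cf; exists (c + c) => d.
have c0 : 0 <= c by apply: le_trans (fc 0 _); rewrite ?in_itv/= ?lexx ?ler01.
apply: modulus_le => [|u v u01 v01]; first exact: addr_ge0.
by rewrite (le_trans (ler_normB _ _))// lerD// fc.
Qed.

Lemma Jint_le c : (forall d, w d <= c) -> Jint n f x <= c.
Proof.
move=> wc; have [rint rE] := rayleigh_density_integral R.
rewrite -[leRHS]mulr1 -rE -RintegralZl//.
apply: le_Rintegral => //; first exact: Jint_integrable wc.
  exact: integrable_scale.
move=> z /=; rewrite in_itv /= andbT => z0.
by rewrite -mulrA ler_wpM2r// mulr_ge0// expR_ge0.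
Qed.

(** The product of [tail_minorant] and 1 + 1 / z^2 is at most 1, so
    error * tail_minorant z <= w (z * sigma) pointwise; integrating against the
    Rayleigh density turns the left side into error / 2. *)
Lemma bernstein_error_le_Jint : bernstein_error n f x <= 2 * Jint n f x.
Proof.
have [c wc] := modulus_bounded.
have [tint tE] := tail_minorant_integral R.
set B := bernstein_error n f x.
suff : B * (1 / 2) <= Jint n f x by lra.
rewrite -tE -RintegralZl//; apply: le_Rintegral => //.
- exact: integrable_scale.
- exact: Jint_integrable wc.
move=> z /=; rewrite in_itv /= andbT => z_ge0.
have [->|z_neq0] := eqVneq z 0.
  (* at z = 0 both integrands carry the factor z *)
  by rewrite !(mul0r, mulr0).
have z0 : 0 < z by rewrite lt0r z_neq0.
rewrite mulrA -[leRHS]mulrA ler_wpM2r ?mulr_ge0 ?expR_ge0//.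
have t0 := tail_minorant_ge0 z.
apply: (@le_trans _ _ (w (scale z) * (1 + z ^- 2) * tail_minorant z)).
  by rewrite ler_wpM2r// bernstein_error_le_scaled_modulus.
rewrite -mulrA -[leRHS]mulr1 ler_wpM2l ?modulus_ge0//.
exact: tail_minorant_le.
Qed.

End BernsteinError.

(** * A function with error one and integral at most one *)

Section Dip.
Variables (R : realType) (x : R).
Hypotheses (x_gt0 : 0 < x) (x_lt1 : x < 1).

(** The parabola t * (1 - t), normalised to 1 at [x], is subtracted from 1; the
    maximum with 0 keeps the values in [0, 1] near t = 1 / 2, where the parabola
    may exceed its value at [x]. *)
Definition dip (t : R) : R := Num.max 0 (1 - t * (1 - t) / (x * (1 - x))).

Let v_gt0 : 0 < x * (1 - x).
Proof. by rewrite mulr_gt0// subr_gt0. Qed.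

Lemma continuous_dip : continuous dip.
Proof.
move=> t; apply: (@continuous_max R R (cst 0)
  (fun t : R => 1 - t * (1 - t) / (x * (1 - x)))); first exact: cvg_cst.
apply: cvgB; first exact: cvg_cst.
apply: cvgM; last exact: cvg_cst.
apply: cvgM; first exact: cvg_id.
by apply: cvgB; [exact: cvg_cst|exact: cvg_id].
Qed.

Lemma dip_center : dip x = 0.
Proof. by rewrite /dip divff ?gt_eqF// subrr maxxx. Qed.

Lemma dip0 : dip 0 = 1.
Proof. by rewrite /dip !mul0r subr0 max_r. Qed.

Lemma dip1 : dip 1 = 1.
Proof. by rewrite /dip subrr mulr0 mul0r subr0 max_r. Qed.

Lemma dip_modulus_le1 d : modulus_of_continuity dip d <= 1.
Proof.
have dip01 t : t \in `[0, 1] -> 0 <= dip t <= 1.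
  rewrite in_itv /= => /andP[t0 t1].
  rewrite /dip le_max lexx ge_max ler01 /= gerBl.
  by rewrite divr_ge0 ?mulr_ge0 ?subr_ge0 ?(ltW x_gt0) ?(ltW x_lt1).
apply: modulus_le => // u v /dip01/andP[u0 u1] /dip01/andP[v0 v1].
by rewrite ler_norml; apply/andP; split; lra.
Qed.

Lemma bernstein_error_dip : bernstein_error 1 dip x = 1.
Proof.
rewrite /bernstein_error /bernstein big_ord_recl big_ord1 /= dip_center.
rewrite mul0r divr1 dip0 dip1 bin0 bin1 subn0 !expr0 !expr1.
by rewrite !mul1r mulr1 subrK subr0 normr1.
Qed.

End Dip.

(** * The two bounds *)

Unset Implicit Arguments.

Theorem theorem3p1 (R : realType) (x : R) (x_gt0 : 0 < x) (x_lt1 : x < 1) :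
  ((pi^-1)%:E <= W x)%E /\ (W x <= 2%:E)%E.
Proof.
split; last first.
  apply: ge_ereal_sup => _ [f [cf _] <-].
  apply: ge_ereal_sup => _ [n n_gt0 <-]; rewrite lee_fin.
  have eJ := bernstein_error_le_Jint cf n_gt0 x_gt0 x_lt1.
  have e0 : 0 <= bernstein_error n f x by exact: normr_ge0.
  have : 0 <= Jint n f x by lra.
  rewrite le_eqVlt => /predU1P[<-|J0]; first by rewrite invr0 mulr0.
  by rewrite ler_pdivrMr.
have cdip : C01 (dip x) by apply: continuous_subspaceT; exact: continuous_dip.
have J1 : Jint 1 (dip x) x <= 1.
  by apply: Jint_le => //; exact: dip_modulus_le1.
have := bernstein_error_le_Jint cdip (ltn0Sn 0) x_gt0 x_lt1.
rewrite bernstein_error_dip// => J2.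
have J0 : 0 < Jint 1 (dip x) x by lra.
apply: (@le_trans _ _ (bernstein_error 1 (dip x) x / Jint 1 (dip x) x)%:E).
  rewrite bernstein_error_dip// lee_fin div1r lef_pV2 ?posrE ?pi_gt0//.
  by apply: le_trans J1 _; have := pi_ge2 R; lra.
apply: (@le_trans _ _ (ereal_sup [set (bernstein_error n (dip x) x /
    Jint n (dip x) x)%:E | n in [set n | (0 < n)%N]])).
  by apply: ereal_sup_ubound; exists 1%N.
apply: ereal_sup_ubound; exists (dip x) => //; split=> // -[c dipc].
have := dipc 0; have := dipc x; rewrite !in_itv /= lexx ler01 !ltW//.
rewrite dip_center// dip0 => /(_ isT) <- /(_ isT) /eqP.
by rewrite oner_eq0.
Qed.
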